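(* Suppose $f:\{-1,1\}^n\to\{-1,1\}$ is computable by a read-$k$ decision tree whose expected depth is $d$, and let $\mathcal{X}\sim\widehat f^2$. Then there is an almost prefix-free protocol for $\mathcal{X}$ over an alphabet $\Sigma$ with $|\Sigma|=3$ whose length is at most $\min\{(2k+2)\cdot\mathbf{I}[f],\ 4\cdot\mathbf{I}[f]+2d\}$.
   Context: Fourier expansion under uniform distribution: $f=\sum_S\widehat f(S)\chi_S$; $\mathcal{X}\sim\widehat f^2$ means $\Pr[\mathcal{X}=S]=\widehat f(S)^2$. Total influence $\mathbf{I}[f]=\sum_S|S|\widehat f(S)^2=\sum_i\Pr_x[f(x)\ne f(x^{\oplus i})]$. A decision tree is read-$k$ if no variable is queried at more than $k$ nodes; its expected depth is the expected number of queries on a uniform random input. A protocol (code) for a random variable taking values in $2^{[n]}$ is a map $P:2^{[n]}\to\Sigma^*$; its length is $\mathbb{E}[|P(\mathcal{X})|]$. It is prefix-free if $P(x)$ is never a prefix of $P(y)$ for distinct $x,y$. It is almost prefix-free if $P(\emptyset)$ is the empty string and $P$ is prefix-free on the nonempty sets (i.e. prefix-free except that it outputs the empty string on input $\emptyset$). It suffices that $P$ correctly encodes the sets $S$ with $\widehat f(S)\neq 0$. *)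

(* Defs.v *)
From HB Require Import structures.
From mathcomp Require Import all_boot all_order all_algebra.

Set Implicit Arguments.
Unset Strict Implicit.
Unset Printing Implicit Defensive.

Import Order.TTheory GRing.Theory Num.Theory.
Local Open Scope ring_scope.

(* The cube {-1,1}^n, in boolean form: the bit b stands for the sign (-1)^b,
   so false is 1 and true is -1.  Outputs in {-1,1} use the same encoding. *)
Definition cube (n : nat) := {ffun 'I_n -> bool}.

Definition bsign (R : realFieldType) (b : bool) : R := (-1) ^+ b.

Definition expect (R : realFieldType) (n : nat) (F : cube n -> R) : R :=
  #|{: cube n}|%:R^-1 * \sum_(x : cube n) F x.

Definition chi (R : realFieldType) (n : nat) (S : {set 'I_n}) (x : cube n) : R :=
  \prod_(i in S) bsign R (x i).

Definition fourier (R : realFieldType) (n : nat) (f : cube n -> bool)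
    (S : {set 'I_n}) : R :=
  expect (fun x => bsign R (f x) * chi R S x).

Definition spectral_dist (R : realFieldType) (n : nat) (f : cube n -> bool)
    (S : {set 'I_n}) : R :=
  fourier R f S ^+ 2.

Definition total_influence (R : realFieldType) (n : nat) (f : cube n -> bool) : R :=
  \sum_(S : {set 'I_n}) #|S|%:R * fourier R f S ^+ 2.

(* A path may query the same variable several times; such repetitions count
   both towards the number of reads and towards the depth. *)
Inductive dtree (n : nat) : Type :=
  | Leaf of bool
  | Query of 'I_n & dtree n & dtree n.

Arguments Leaf {n} b.
Arguments Query {n} i t0 t1.

Fixpoint dt_eval (n : nat) (t : dtree n) (x : cube n) : bool :=
  match t with
  | Leaf b => b
  | Query i t0 t1 => if x i then dt_eval t1 x else dt_eval t0 x
  end.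

Definition computes (n : nat) (t : dtree n) (f : cube n -> bool) : Prop :=
  forall x, dt_eval t x = f x.

Fixpoint dt_reads (n : nat) (t : dtree n) (i : 'I_n) : nat :=
  match t with
  | Leaf _ => 0%N
  | Query j t0 t1 => ((j == i) + (dt_reads t0 i + dt_reads t1 i))%N
  end.

Definition read_k (n k : nat) (t : dtree n) : Prop :=
  forall i, (dt_reads t i <= k)%N.

Fixpoint dt_queries (n : nat) (t : dtree n) (x : cube n) : nat :=
  match t with
  | Leaf _ => 0%N
  | Query i t0 t1 => (if x i then dt_queries t1 x else dt_queries t0 x).+1
  end.

Definition expected_depth (R : realFieldType) (n : nat) (t : dtree n) : R :=
  expect (fun x => (dt_queries t x)%:R).

Definition almost_prefix_free (n : nat) (Sigma : eqType)
    (P : {set 'I_n} -> seq Sigma) : Prop :=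
  P set0 = [::] /\
  forall S T : {set 'I_n},
    S != set0 -> T != set0 -> S != T -> ~~ prefix (P S) (P T).

Definition code_length (R : realFieldType) (n : nat) (Sigma : Type)
    (mu : {set 'I_n} -> R) (P : {set 'I_n} -> seq Sigma) : R :=
  \sum_(S : {set 'I_n}) mu S * (size (P S))%:R.

(* Main.v *)
(** Remove repeated queries along paths. If the root queries [i] and the subtrees
    compute [f0] and [f1], then for [i] not in [S] the masses of [S] and [i |: S]
    under the spectral distribution of [f] add up to the average of the masses of
    [S] under those of [f0] and [f1]. Hence a set is encoded recursively: one
    letter for the subtree whose codeword for [S :\ i] is shorter, one letter for
    the membership of [i], then that codeword; the third letter encodes [{i}]. A
    node costs at most 2 letters, and only when the set is nonempty, so the length
    is at most twice the sum over the nodes [v] of Pr[reach v] Var[f_v].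

    This sum is at most the expected depth. By the OSSS inequality, Var[f_v] is at
    most the sum over the descendants [w] of [v] of Pr[w | v] Inf_w[f_v], where
    Inf_w is the influence of the variable queried at [w]. The terms [w = v] add
    up to I[f], and as Pr[v] Inf_w[f_v] <= Inf_w[f], the terms with [w] strictly
    below [v] contribute at most (1/2 + 1/4 + ...) Inf_w[f] for each node [w], in
    total at most k I[f]. *)
Require Import Defs.
From mathcomp Require Import all_boot all_order all_algebra.
From mathcomp Require Import ring lra.
Import Order.TTheory GRing.Theory Num.Theory.
Local Open Scope ring_scope.

Set Implicit Arguments.
Unset Strict Implicit.
Unset Printing Implicit Defensive.

(** * Coordinate flips, expectations and influences on the cube *)

Definition flip (n : nat) (i : 'I_n) (x : cube n) : cube n :=
  [ffun j => x j (+) (j == i)].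

Lemma flipK (n : nat) (i : 'I_n) : involutive (flip i).
Proof. by move=> x; apply/ffunP=> j; rewrite !ffunE addbK. Qed.

Lemma flipC (n : nat) (i j : 'I_n) (x : cube n) :
  flip i (flip j x) = flip j (flip i x).
Proof. by apply/ffunP=> l; rewrite !ffunE addbAC. Qed.

Lemma flip_same (n : nat) (i : 'I_n) (x : cube n) : flip i x i = ~~ x i.
Proof. by rewrite ffunE eqxx addbT. Qed.

Lemma flip_other (n : nat) (i j : 'I_n) (x : cube n) :
  i != j -> flip j x i = x i.
Proof. by move=> /negPf ne; rewrite ffunE ne addbF. Qed.

Section Expectation.
Variables (R : realFieldType) (n : nat).
Implicit Types (a : R) (F G h : cube n -> R).

Lemma eq_expect F G : F =1 G -> expect F = expect G.
Proof. by move=> e; rewrite /expect (eq_bigr G). Qed.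

Lemma expectD F G : expect (fun x => F x + G x) = expect F + expect G.
Proof. by rewrite /expect big_split mulrDr. Qed.

Lemma expectZ a F : expect (fun x => a * F x) = a * expect F.
Proof. by rewrite /expect -mulr_sumr mulrCA. Qed.

Lemma card_cube_neq0 : #|{: cube n}|%:R != 0 :> R.
Proof. by rewrite pnatr_eq0 -lt0n; apply/card_gt0P; exists [ffun=> false]. Qed.

Lemma expect_cst (a : R) : expect (fun _ : cube n => a) = a.
Proof.
by rewrite /expect sumr_const -[X in _ * X]mulr_natl mulKf // card_cube_neq0.
Qed.

Lemma le_expect F G : (forall x, F x <= G x) -> expect F <= expect G.
Proof. by move=> le; rewrite ler_wpM2l ?invr_ge0 ?ler0n ?ler_sum. Qed.

Lemma expect_ge0 F : (forall x, 0 <= F x) -> 0 <= expect F.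
Proof. by move=> ge0; rewrite mulr_ge0 ?invr_ge0 ?ler0n ?sumr_ge0. Qed.

Lemma expect_flip i F : expect (fun x => F (flip i x)) = expect F.
Proof.
by rewrite /expect [in RHS](reindex_inj (inv_inj (@flipK n i))).
Qed.

Definition flip_invariant (T : Type) i (F : cube n -> T) :=
  forall x, F (flip i x) = F x.

(** Averaging the integrand over [x] and [flip i x] meets each branch exactly once. *)
Lemma expect_if i F G : flip_invariant i F -> flip_invariant i G ->
  expect (fun x => if x i then G x else F x) = (expect F + expect G) / 2.
Proof.
move=> iF iG; rewrite -expectD mulrC -expectZ.
set H := fun x => _.
have -> : expect H = expect (fun x => 2^-1 * (H x + H (flip i x))).
  by rewrite expectZ expectD expect_flip; lra.
by apply: eq_expect => x; rewrite /H flip_same iF iG; case: (x i) => /=; lra.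
Qed.

(** For sign-valued [h] this is the probability that flipping [i] changes [h]. The L1 form also
    suits the real-valued averages in the OSSS induction. *)
Definition influence (h : cube n -> R) (i : 'I_n) : R :=
  expect (fun x => `|h x - h (flip i x)| / 2).

Lemma influence_ge0 h i : 0 <= influence h i.
Proof. by apply: expect_ge0 => x; rewrite divr_ge0 ?normr_ge0. Qed.

Lemma influence_invariant h i : flip_invariant i h -> influence h i = 0.
Proof.
move=> ih; rewrite -(expect_cst 0); apply: eq_expect => x.
by rewrite ih subrr normr0 mul0r.
Qed.

Lemma influence_if i j F G : j != i ->
  flip_invariant i F -> flip_invariant i G ->
  influence (fun x => if x i then G x else F x) j =
    (influence F j + influence G j) / 2.
Proof.
move=> ne iF iG; rewrite /influence -(@expect_if i).
- apply: eq_expect => x; rewrite flip_other 1?eq_sym //.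
  by case: (x i).
- by move=> x; rewrite flipC !iF.
- by move=> x; rewrite flipC !iG.
Qed.

Definition smooth i (h : cube n -> R) (x : cube n) : R :=
  (h x + h (flip i x)) / 2.

Lemma smooth_invariant i h : flip_invariant i (smooth i h).
Proof. by move=> x; rewrite /smooth flipK addrC. Qed.

Lemma expect_smooth i h : expect (smooth i h) = expect h.
Proof.
have -> : expect (smooth i h) = expect (fun x => 2^-1 * (h x + h (flip i x))).
  by apply: eq_expect => x; rewrite /smooth mulrC.
by rewrite expectZ expectD expect_flip; lra.
Qed.

(** Flips commute, so the difference of the average is the average of the differences; then the
    triangle inequality applies. *)
Lemma influence_smooth i h j : influence (smooth i h) j <= influence h j.
Proof.
have -> : influence h j =
    expect (smooth i (fun x => `|h x - h (flip j x)| / 2)).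
  by rewrite expect_smooth.
apply: le_expect => x; rewrite /smooth ler_pM2r ?invr_gt0 ?ltr0n // (flipC i j).
have -> : (h x + h (flip i x)) / 2 - (h (flip j x) + h (flip j (flip i x))) / 2
  = (h x - h (flip j x)) / 2 + (h (flip i x) - h (flip j (flip i x))) / 2.
  by lra.
by apply: le_trans (ler_normD _ _) _; rewrite !normrM (@ger0_norm _ 2^-1) ?invr_ge0.
Qed.

End Expectation.

(** * Fourier analysis: Parseval, total influence, variance, splitting on a variable *)

Section Fourier.
Variables (R : realFieldType) (n : nat).

Definition fourier_coef (h : cube n -> R) (S : {set 'I_n}) : R :=
  expect (fun x => h x * chi R S x).

Lemma bsign_sqr b : bsign R b ^+ 2 = 1.
Proof. by rewrite /bsign -exprM mulnC exprM sqrrN expr1n expr1n. Qed.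

Lemma bsign_mul b c : bsign R b * bsign R c = bsign R (b (+) c).
Proof. by rewrite /bsign signr_addb. Qed.

Lemma norm_bsign b : `|bsign R b| = 1.
Proof. by rewrite /bsign normrX normrN1 expr1n. Qed.

(** The sum factors over the coordinates, and a coordinate where [x] and [y] differ gives the factor
    [-1 + 1]. *)
Lemma sum_chi (x y : cube n) :
  \sum_(S : {set 'I_n}) chi R S x * chi R S y =
    (if x == y then #|{: cube n}|%:R else 0).
Proof.
have -> : \sum_(S : {set 'I_n}) chi R S x * chi R S y =
    \prod_(i : 'I_n) (bsign R (x i (+) y i) + 1).
  rewrite bigA_distr; apply: eq_bigr => S _.
  rewrite /chi -big_split /= big_mkcond /=; apply: eq_bigr => i _.
  by rewrite bsign_mul.
case: eqP => [->|/eqP ne].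
  rewrite (eq_bigr (fun=> 2%:R)) => [|i _]; last by rewrite addbb /bsign expr0 -natr1.
  by rewrite prodr_const !card_ffun card_bool card_ord natrX.
have [i ne_i] : exists i, x i != y i.
  apply/existsP; apply: contraR ne; rewrite negb_exists => /forallP e.
  by apply/eqP/ffunP => i; apply/eqP; rewrite -[_ == _]negbK e.
rewrite (bigD1 i) //= /bsign.
have -> : x i (+) y i = true by case: (x i) (y i) ne_i => [] [].
by rewrite expr1 addNr mul0r.
Qed.

Lemma parseval (h : cube n -> R) : \sum_(S : {set 'I_n}) fourier_coef h S ^+ 2 =
  expect (fun x => h x ^+ 2).
Proof.
set c := #|{: cube n}|%:R^-1 : R.
have E S : fourier_coef h S ^+ 2 =
    c ^+ 2 * \sum_x \sum_y h x * h y * (chi R S x * chi R S y).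
  rewrite /fourier_coef /expect exprMn; congr (_ * _).
  rewrite expr2 mulr_suml; apply: eq_bigr => x _.
  by rewrite mulr_sumr; apply: eq_bigr => y _; rewrite mulrACA.
rewrite (eq_bigr _ (fun S _ => E S)) -mulr_sumr exchange_big /= expr2 -mulrA.
congr (_ * _); rewrite mulr_sumr; apply: eq_bigr => x _.
rewrite exchange_big /= (bigD1 x) //= -mulr_sumr sum_chi eqxx big1 => [|y ne].
  by rewrite addr0 mulrC mulfK ?card_cube_neq0 ?expr2.
by rewrite -mulr_sumr sum_chi eq_sym (negPf ne) mulr0.
Qed.

Lemma chi_flip S i (x : cube n) :
  chi R S (flip i x) = bsign R (i \in S) * chi R S x.
Proof.
have [iS|niS] := boolP (i \in S); last first.
  rewrite /bsign expr0 mul1r; apply: eq_bigr => j jS.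
  by rewrite flip_other //; apply: contraNneq niS => <-.
rewrite /chi (bigD1 i) //= [in RHS](bigD1 i) //= flip_same mulrA.
congr (_ * _); first by rewrite bsign_mul; case: (x i).
by apply: eq_bigr => j /andP[_ ne]; rewrite flip_other.
Qed.

(** Flipping [i] negates [chi R S] exactly when [i] lies in [S]. *)
Lemma fourier_coef_diff (h : cube n -> R) i S :
  fourier_coef (fun x => (h x - h (flip i x)) / 2) S =
    (if i \in S then fourier_coef h S else 0).
Proof.
have E : expect (fun x => h (flip i x) * chi R S x) =
    bsign R (i \in S) * fourier_coef h S.
  rewrite -expectZ -(expect_flip i); apply: eq_expect => x.
  by rewrite flipK chi_flip mulrCA.
have -> : fourier_coef (fun x => (h x - h (flip i x)) / 2) S =
    expect (fun x => 2^-1 * (h x * chi R S x + -1 * (h (flip i x) * chi R S x))).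
  by apply: eq_expect => x; ring.
rewrite expectZ expectD expectZ E /bsign -/(fourier_coef h S).
by case: (i \in S); rewrite ?expr0 ?expr1; lra.
Qed.

Lemma total_influenceE (f : cube n -> bool) :
  total_influence R f = \sum_i influence (fun x => bsign R (f x)) i.
Proof.
set h := fun x => bsign R (f x).
have E i : influence h i = \sum_(S : {set 'I_n} | i \in S) fourier R f S ^+ 2.
  (* The half-difference of signs is -1, 0 or 1, so its absolute value is its square and Parseval
     applies. *)
  have -> : influence h i = expect (fun x => ((h x - h (flip i x)) / 2) ^+ 2).
    apply: eq_expect => x; rewrite /h /bsign.
    case: (f x) (f (flip i x)) => [] []; rewrite ?expr0 ?expr1.
    - by rewrite subrr normr0; ring.
    - by rewrite distrC ger0_norm; lra.
    - by rewrite ger0_norm; lra.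
    - by rewrite subrr normr0; ring.
  rewrite -parseval [RHS]big_mkcond; apply: eq_bigr => S _.
  by rewrite fourier_coef_diff; case: ifP => // _; rewrite expr0n.
rewrite (eq_bigr _ (fun i _ => E i)) (exchange_big_dep xpredT) //=.
by apply: eq_bigr => S _; rewrite sumr_const mulr_natl.
Qed.

(** The 1 is the second moment of a sign-valued function. *)
Definition variance (f : cube n -> bool) : R := 1 - fourier R f set0 ^+ 2.

Lemma chi0 (x : cube n) : chi R set0 x = 1.
Proof. by rewrite /chi big_set0. Qed.

Lemma fourier0 (f : cube n -> bool) :
  fourier R f set0 = expect (fun x => bsign R (f x)).
Proof. by apply: eq_expect => x; rewrite chi0 mulr1. Qed.

Lemma varianceE (f : cube n -> bool) :
  variance f = \sum_(S : {set 'I_n} | S != set0) fourier R f S ^+ 2.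
Proof.
have := parseval (fun x => bsign R (f x)).
rewrite (eq_expect (G := fun=> 1)) => [|x]; last by rewrite bsign_sqr.
rewrite expect_cst (bigD1 set0) //= => e.
by apply/eqP; rewrite subr_eq addrC; apply/eqP/esym.
Qed.

Section Split.
Variables (i : 'I_n) (f0 f1 : cube n -> bool).
Hypotheses (i0 : flip_invariant i f0) (i1 : flip_invariant i f1).
Let f (x : cube n) := if x i then f1 x else f0 x.

Lemma fourier_if_notin (S : {set 'I_n}) : i \notin S ->
  fourier R f S = (fourier R f0 S + fourier R f1 S) / 2.
Proof.
move=> niS; rewrite /fourier -(@expect_if R n i).
- by apply: eq_expect => x; rewrite /f; case: (x i).
- by move=> x; rewrite chi_flip i0 (negPf niS) /bsign expr0 mul1r.
- by move=> x; rewrite chi_flip i1 (negPf niS) /bsign expr0 mul1r.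
Qed.

Lemma fourier_if_in (S : {set 'I_n}) : i \notin S ->
  fourier R f (i |: S) = (fourier R f0 S - fourier R f1 S) / 2.
Proof.
move=> niS.
have -> : - fourier R f1 S = expect (fun x => -1 * (bsign R (f1 x) * chi R S x)).
  by rewrite expectZ mulN1r.
rewrite /fourier -(@expect_if R n i).
- apply: eq_expect => x; rewrite /f /chi big_setU1 //= -/(chi R S x).
  by case: (x i); rewrite /bsign ?expr0 ?expr1; ring.
- by move=> x; rewrite chi_flip i0 (negPf niS) /bsign expr0 mul1r.
- by move=> x; rewrite chi_flip i1 (negPf niS) /bsign expr0 mul1r.
Qed.

(** The two coefficients are half the sum and half the difference of those of the branches, so the
    cross terms cancel. *)
Lemma spectral_if (S : {set 'I_n}) : i \notin S ->
  fourier R f S ^+ 2 + fourier R f (i |: S) ^+ 2 =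
    (fourier R f0 S ^+ 2 + fourier R f1 S ^+ 2) / 2.
Proof.
by move=> niS; rewrite fourier_if_notin // fourier_if_in //; field.
Qed.

End Split.
End Fourier.

Lemma sum_set_split (R : realFieldType) (n : nat) (i : 'I_n)
    (G : {set 'I_n} -> R) :
  \sum_S G S = \sum_(S : {set 'I_n} | i \notin S) (G S + G (i |: S)).
Proof.
rewrite (bigID (fun S : {set 'I_n} => i \notin S)) big_split /=.
congr (_ + _).
rewrite (reindex_onto (fun S => i |: S) (fun S => S :\ i)) /=; last first.
  by move=> S; rewrite negbK => iS; rewrite setD1K.
apply: eq_bigl => S; rewrite negbK setU11 /=.
apply/eqP/idP => [<-|niS]; first by rewrite setD11.
by rewrite setU1K.
Qed.

(** * Pruning repeated queries from a decision tree *)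

Section Trees.
Variable n : nat.
Implicit Types (t : dtree n) (i j : 'I_n) (x : cube n).

Fixpoint repeat_free t : bool :=
  if t is Query i t0 t1 then
    [&& dt_reads t0 i == 0%N, dt_reads t1 i == 0%N, repeat_free t0 & repeat_free t1]
  else true.

Fixpoint restrict i (b : bool) t : dtree n :=
  if t is Query j t0 t1 then
    if j == i then restrict i b (if b then t1 else t0)
    else Query j (restrict i b t0) (restrict i b t1)
  else t.

(** Pruning the children before restricting them keeps the recursion structural. *)
Fixpoint prune t : dtree n :=
  if t is Query i t0 t1 then
    Query i (restrict i false (prune t0)) (restrict i true (prune t1))
  else t.

(** The zero case yields repeat-freeness of pruned trees; the other case preserves the read
    bound. *)
Lemma restrict_reads i b t j :
  (dt_reads (restrict i b t) j <= if j == i then 0 else dt_reads t j)%N.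
Proof.
elim: t => [c|l t0 IH0 t1 IH1] /=; first by case: ifP.
case: (eqVneq l i) => [->|ne].
  case: b IH0 IH1 => IH0 IH1; apply: leq_trans (_ : _ <= _)%N; try eassumption.
    by case: ifP => // _; rewrite addnA leq_addl.
  by case: ifP => // _; rewrite addnCA leq_addr.
move: IH0 IH1 => /=; case: (eqVneq j i) => [->|_] /=.
  by rewrite (negPf ne) !leqn0 => /eqP-> /eqP->.
by move=> IH0 IH1; rewrite leq_add2l leq_add.
Qed.

Lemma restrict_repeat_free i b t : repeat_free t -> repeat_free (restrict i b t).
Proof.
elim: t => [//|j t0 IH0 t1 IH1] /= /and4P[r0 r1 f0 f1].
case: ifP => _; first by case: b IH0 IH1 => IH0 IH1; auto.
have r t : dt_reads t j == 0%N -> dt_reads (restrict i b t) j == 0%N.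
  move=> /eqP e; rewrite -leqn0; apply: leq_trans (restrict_reads _ _ _ _) _.
  by rewrite e; case: ifP.
by rewrite /= !r // IH0 // IH1.
Qed.

Lemma restrict_eval i t x : dt_eval (restrict i (x i) t) x = dt_eval t x.
Proof.
elim: t => [//|j t0 IH0 t1 IH1] /=.
case: eqP => [->|_] /=; last by rewrite IH0 IH1.
by move: IH0 IH1; case: (x i).
Qed.

Lemma restrict_queries i t x :
  (dt_queries (restrict i (x i) t) x <= dt_queries t x)%N.
Proof.
elim: t => [//|j t0 IH0 t1 IH1] /=.
case: eqP => [->|_] /=; last by case: (x j).
by move: IH0 IH1; case: (x i) => IH0 IH1; apply: leqW.
Qed.

Lemma prune_repeat_free t : repeat_free (prune t).
Proof.
elim: t => [//|i t0 IH0 t1 IH1] /=.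
rewrite !restrict_repeat_free // -!leqn0 !andbT.
by apply/andP; split; apply: leq_trans (restrict_reads _ _ _ _) _; rewrite eqxx.
Qed.

Lemma prune_reads t i : (dt_reads (prune t) i <= dt_reads t i)%N.
Proof.
elim: t => [//|j t0 IH0 t1 IH1] /=; rewrite leq_add2l.
by apply: leq_add; apply: leq_trans (restrict_reads _ _ _ _) _; case: ifP.
Qed.

Lemma prune_eval t x : dt_eval (prune t) x = dt_eval t x.
Proof.
elim: t => [//|j t0 IH0 t1 IH1] /=; rewrite -IH0 -IH1.
by case E: (x j); rewrite -E restrict_eval.
Qed.

Lemma prune_queries t x : (dt_queries (prune t) x <= dt_queries t x)%N.
Proof.
elim: t => [//|j t0 IH0 t1 IH1] /=; rewrite ltnS.
by case E: (x j); rewrite -[X in restrict _ X]E;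
  apply: leq_trans (restrict_queries _ _ _) _.
Qed.

Lemma unread_eval t i : dt_reads t i == 0%N -> flip_invariant i (dt_eval t).
Proof.
move=> r x; elim: t r => [//|j t0 IH0 t1 IH1] /=.
rewrite !addn_eq0 eqb0 => /and3P[ne r0 r1].
by rewrite flip_other // IH0 // IH1.
Qed.

Lemma unread_queries t i : dt_reads t i == 0%N -> flip_invariant i (dt_queries t).
Proof.
move=> r x; elim: t r => [//|j t0 IH0 t1 IH1] /=.
rewrite !addn_eq0 eqb0 => /and3P[ne r0 r1].
by rewrite flip_other // IH0 // IH1.
Qed.

End Trees.

(** * Weights along paths, the OSSS inequality, and the two bounds on the sum of variances *)

Section Costs.
Variables (R : realFieldType) (n : nat).
Implicit Types (t : dtree n) (i j : 'I_n) (x : cube n) (a b : 'I_n -> R).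

Definition sgn_eval t (x : cube n) : R := bsign R (dt_eval t x).

Lemma sgn_evalE i t0 t1 x :
  sgn_eval (Query i t0 t1) x = if x i then sgn_eval t1 x else sgn_eval t0 x.
Proof. by rewrite /sgn_eval /=; case: (x i). Qed.

Lemma unread_sgn t i : dt_reads t i == 0%N -> flip_invariant i (sgn_eval t).
Proof. by move=> r x; rewrite /sgn_eval unread_eval. Qed.

(* For a repeat-free tree a node at depth [l] is reached with probability
   [2^-l], so this is the expectation of the total weight of the queried
   variables. *)
Fixpoint path_weight t a : R :=
  if t is Query i t0 t1 then a i + (path_weight t0 a + path_weight t1 a) / 2
  else 0.

Fixpoint node_weight t a : R :=
  if t is Query i t0 t1 then a i + (node_weight t0 a + node_weight t1 a) else 0.

(** For a repeat-free tree, the sum over nodes [v] of Pr[reach v] Var[f_v]. *)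
Fixpoint path_variance t : R :=
  if t is Query i t0 t1 then
    variance R (dt_eval t) + (path_variance t0 + path_variance t1) / 2
  else 0.

Lemma le_path_weight t a b :
  (forall i, a i <= b i) -> path_weight t a <= path_weight t b.
Proof.
move=> le; elim: t => [//|i t0 IH0 t1 IH1] /=.
by have := le i; lra.
Qed.

Lemma le_node_sub_path_weight t a b : (forall i, a i <= b i) ->
  node_weight t a - path_weight t a <= node_weight t b - path_weight t b.
Proof.
move=> le; elim: t => [//|i t0 IH0 t1 IH1] /=.
by have := le_path_weight t0 le; have := le_path_weight t1 le; lra.
Qed.

Lemma path_weightZ t c a : path_weight t (fun i => c * a i) = c * path_weight t a.
Proof.
elim: t => [|i t0 IH0 t1 IH1] /=; first by rewrite mulr0.
by rewrite IH0 IH1; ring.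
Qed.

Lemma node_weightZ t c a : node_weight t (fun i => c * a i) = c * node_weight t a.
Proof.
elim: t => [|i t0 IH0 t1 IH1] /=; first by rewrite mulr0.
by rewrite IH0 IH1; ring.
Qed.

Lemma path_weight_ge0 t a : (forall i, 0 <= a i) -> 0 <= path_weight t a.
Proof.
move=> ge0; elim: t => [//|i t0 IH0 t1 IH1] /=; by have := ge0 i; lra.
Qed.

(** Grouping the nodes by queried variable is what lets the read bound enter. *)
Lemma node_weightE t a : node_weight t a = \sum_j (dt_reads t j)%:R * a j.
Proof.
elim: t => [|i t0 IH0 t1 IH1] /=.
  by rewrite big1 // => j _; rewrite mul0r.
rewrite IH0 IH1 -big_split [RHS](eq_bigr (fun j => (i == j)%:R * a j +
  ((dt_reads t0 j)%:R * a j + (dt_reads t1 j)%:R * a j))); last first.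
  by move=> j _; rewrite !natrD !mulrDl.
rewrite [in RHS]big_split /=; congr (_ + _).
rewrite (bigD1 i) //= eqxx mul1r big1 ?addr0 // => j.
by rewrite eq_sym => /negPf->; rewrite mul0r.
Qed.

(* The inequality of O'Donnell, Saks, Schramm and Servedio, for an arbitrary
   second function [h] because the induction replaces [h] by its average over
   the root variable. *)
Lemma osss_covariance t (h : cube n -> R) : repeat_free t ->
  expect (fun x => sgn_eval t x * h x) - expect (sgn_eval t) * expect h
    <= path_weight t (influence h).
Proof.
elim: t h => [b|i t0 IH0 t1 IH1] h /=.
  by rewrite expectZ expect_cst subrr.
move=> /and4P[r0 r1 f0 f1].
(* The subtrees do not read [i], so they correlate only with the average of [h] over that
   variable. *)
pose hb := smooth i h.
have le0 := le_path_weight t0 (influence_smooth i h).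
have le1 := le_path_weight t1 (influence_smooth i h).
have := IH0 hb f0; have := IH1 hb f1; rewrite expect_smooth.
have ihb : flip_invariant i hb := @smooth_invariant R n i h.
have i0 := unread_sgn r0; have i1 := unread_sgn r1.
have -> : expect (sgn_eval (Query i t0 t1)) =
    (expect (sgn_eval t0) + expect (sgn_eval t1)) / 2.
  by rewrite -(expect_if i0 i1); apply: eq_expect => x; rewrite sgn_evalE.
(* Replacing [h] by [hb] costs at most the mean of [|h - hb|], which is the influence of [i]. *)
have : expect (fun x => sgn_eval (Query i t0 t1) x * h x) <=
    (expect (fun x => sgn_eval t0 x * hb x) +
     expect (fun x => sgn_eval t1 x * hb x)) / 2 + influence h i.
  rewrite -(@expect_if _ _ i).
  - rewrite /influence -expectD; apply: le_expect => x.
    have -> : (if x i then sgn_eval t1 x * hb x else sgn_eval t0 x * hb x) =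
      sgn_eval (Query i t0 t1) x * hb x by rewrite sgn_evalE; case: (x i).
    rewrite -lerBlDl -mulrBr; apply: le_trans (ler_norm _) _.
    rewrite normrM norm_bsign mul1r /hb /smooth.
    have -> : h x - (h x + h (flip i x)) / 2 = (h x - h (flip i x)) / 2 by lra.
    by rewrite normrM (@ger0_norm _ 2^-1) ?invr_ge0.
  - by move=> x; rewrite i0 ihb.
  - by move=> x; rewrite i1 ihb.
move: le0 le1; rewrite -/hb mulrDl; lra.
Qed.

(** The covariance of the tree's sign function with itself is its variance. *)
Lemma osss t : repeat_free t ->
  variance R (dt_eval t) <= path_weight t (influence (sgn_eval t)).
Proof.
move=> rf; apply: le_trans (osss_covariance _ rf).
rewrite (eq_expect (G := fun=> 1)) => [|x]; last by rewrite -expr2 bsign_sqr.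
by rewrite expect_cst /variance fourier0 expr2.
Qed.

Lemma influence_query i j t0 t1 : j != i ->
  dt_reads t0 i == 0%N -> dt_reads t1 i == 0%N ->
  influence (sgn_eval (Query i t0 t1)) j =
    (influence (sgn_eval t0) j + influence (sgn_eval t1) j) / 2.
Proof.
move=> ne r0 r1; rewrite -(influence_if ne (unread_sgn r0) (unread_sgn r1)).
by apply: eq_expect => x; rewrite !sgn_evalE.
Qed.

(* The path weight on the left strengthens the induction: restricting a variable
   at most doubles each influence, which the averaging over the two children
   absorbs since node_weight - path_weight has the nonnegative coefficient
   [1 - 2^-l] on a node at depth [l]. *)
Lemma path_variance_influence t : repeat_free t ->
  path_variance t + path_weight t (influence (sgn_eval t)) <=
    \sum_j influence (sgn_eval t) j + node_weight t (influence (sgn_eval t)).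
Proof.
elim: t => [b|i t0 IH0 t1 IH1].
  by move=> _ /=; rewrite !addr0 sumr_ge0 // => j _; apply: influence_ge0.
move=> rf; have := osss rf; move: rf => /= /and4P[r0 r1 f0 f1].
set I := influence (sgn_eval (Query i t0 t1)).
move: (IH0 f0) (IH1 f1).
set I0 := influence (sgn_eval t0); set I1 := influence (sgn_eval t1).
have z0 : I0 i = 0 by apply/influence_invariant/unread_sgn.
have z1 : I1 i = 0 by apply/influence_invariant/unread_sgn.
have Ij j : j != i -> I j = (I0 j + I1 j) / 2 by move=> ne; apply: influence_query.
have p0 j : 0 <= I0 j by apply: influence_ge0.
have p1 j : 0 <= I1 j by apply: influence_ge0.
have pI j : 0 <= I j by apply: influence_ge0.
have sumI : \sum_j I j = I i + (\sum_j I0 j + \sum_j I1 j) / 2.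
  rewrite -big_split /= (bigD1 i) //=; congr (_ + _).
  rewrite [in RHS](bigD1 i) //= z0 z1 !add0r mulr_suml.
  exact: eq_bigr.
have l0 j : 2^-1 * I0 j <= I j.
  case: (eqVneq j i) => [->|ne]; first by rewrite z0 mulr0.
  by rewrite Ij //; have := p1 j; lra.
have l1 j : 2^-1 * I1 j <= I j.
  case: (eqVneq j i) => [->|ne]; first by rewrite z1 mulr0.
  by rewrite Ij //; have := p0 j; lra.
(* Half of each subtree's path weight comes from OSSS and half from the left-hand side; together
   they cancel the path weights subtracted by the induction hypotheses. *)
move: (le_node_sub_path_weight t0 l0) (le_node_sub_path_weight t1 l1).
rewrite !node_weightZ !path_weightZ sumI; lra.
Qed.

(** The node weight gives [k] copies of the total influence, and the plain sum of influences gives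
    one more. *)
Lemma path_variance_reads t k : repeat_free t -> read_k k t ->
  path_variance t <= k.+1%:R * total_influence R (dt_eval t).
Proof.
move=> rf rk; have := path_variance_influence rf; rewrite total_influenceE.
have ge0 := @influence_ge0 R n (sgn_eval t).
have : node_weight t (influence (sgn_eval t)) <=
    k%:R * \sum_j influence (sgn_eval t) j.
  rewrite node_weightE mulr_sumr; apply: ler_sum => j _.
  by rewrite ler_wpM2r // ler_nat.
have := path_weight_ge0 t ge0.
by rewrite -natr1 mulrDl mul1r -/(sgn_eval t); lra.
Qed.

(** Each variance is at most 1, and the reach probabilities of the nodes add up to the expected
    depth. *)
Lemma path_variance_depth t : repeat_free t ->
  path_variance t <= expected_depth R t.
Proof.
elim: t => [b|i t0 IH0 t1 IH1].
  by move=> _; apply: expect_ge0 => x; apply: ler0n.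
move=> /= /and4P[r0 r1 f0 f1].
have -> : expected_depth R (Query i t0 t1) =
    1 + (expected_depth R t0 + expected_depth R t1) / 2.
  rewrite -(@expect_if _ _ i).
  - rewrite -[X in X + _](@expect_cst R n) -expectD; apply: eq_expect => x /=.
    by rewrite -natr1 addrC; case: (x i).
  - by move=> x; rewrite unread_queries.
  - by move=> x; rewrite unread_queries.
have : variance R (dt_eval (Query i t0 t1)) <= 1.
  by rewrite /variance lerBlDr lerDl sqr_ge0.
by move: (IH0 f0) (IH1 f1) => /=; lra.
Qed.

End Costs.

(** * The recursive code: prefix-freeness and length *)

Section Code.
Variables (n : nat) (Sigma : finType) (s0 s1 s2 : Sigma).
Implicit Types (t : dtree n) (S T : {set 'I_n}).

Definition letter (b : bool) : Sigma := if b then s1 else s0.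

Definition indicator_code S : seq Sigma :=
  [seq letter (i \in S) | i <- enum 'I_n].

(* On a leaf all nonempty sets have spectral mass zero, so any prefix-free code
   may be used there. *)
Fixpoint tree_code t S : seq Sigma :=
  if S == set0 then [::] else
  match t with
  | Leaf _ => indicator_code S
  | Query i t0 t1 =>
      if S :\ i == set0 then [:: s2] else
      let w0 := tree_code t0 (S :\ i) in
      let w1 := tree_code t1 (S :\ i) in
      let b := (size w1 <= size w0)%N in
      [:: letter b, letter (i \in S) & if b then w1 else w0]
  end.

Lemma tree_code0 t : tree_code t set0 = [::].
Proof. by case: t => /= [b|i t0 t1]; rewrite eqxx. Qed.

Hypotheses (s01 : s0 != s1) (s02 : s0 != s2) (s12 : s1 != s2).

Lemma letter_inj : injective letter.
Proof. by move=> [] [] //= e; move: s01; rewrite e eqxx. Qed.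

Lemma letter_neq b : letter b != s2.
Proof. by case: b. Qed.

Lemma indicator_code_prefix S T :
  prefix (indicator_code S) (indicator_code T) -> S = T.
Proof.
rewrite prefixE take_oversize ?size_map // => /eqP /eq_in_map e.
by apply/setP => i; apply: letter_inj; rewrite e ?mem_enum.
Qed.

Lemma eq_setD1 i S T : S :\ i = T :\ i -> (i \in S) = (i \in T) -> S = T.
Proof.
move=> e ei; apply/setP => j; have [->//|ne] := eqVneq j i.
by move/setP/(_ j): e; rewrite !inE ne.
Qed.

Lemma setD1_eq0 i S : S != set0 -> S :\ i == set0 -> i \in S.
Proof.
move=> nS; apply: contraTT => niS; suff -> : S :\ i = S by [].
by apply/setDidPl; rewrite disjoint_sym disjoints1.
Qed.

(** Only the codeword of [[set i]] starts with [s2]. Otherwise the first letter names the subtree,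
    the second the membership of [i], and induction recovers the nonempty rest. *)
Lemma tree_code_prefix t S T : S != set0 -> T != set0 ->
  prefix (tree_code t S) (tree_code t T) -> S = T.
Proof.
elim: t S T => [b|i t0 IH0 t1 IH1] S T nS nT /=.
  by rewrite (negPf nS) (negPf nT); apply: indicator_code_prefix.
rewrite (negPf nS) (negPf nT).
have [eS|neS] := boolP (S :\ i == set0); have [eT|neT] := boolP (T :\ i == set0).
- move=> _; apply: (@eq_setD1 i); first by rewrite (eqP eS) (eqP eT).
  by rewrite !setD1_eq0.
- by rewrite /= eq_sym (negPf (letter_neq _)).
- by rewrite /= (negPf (letter_neq _)).
rewrite prefix_cons => /andP[/eqP/letter_inj->].
rewrite prefix_cons => /andP[/eqP/letter_inj eb].
by case: ifP => _ p; apply: (@eq_setD1 i) => //; [apply: IH1 | apply: IH0].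
Qed.

Lemma tree_code_almost_prefix_free t : almost_prefix_free (tree_code t).
Proof.
split=> [|S T nS nT]; first exact: tree_code0.
by apply: contraNN => p; rewrite (tree_code_prefix nS nT p).
Qed.

Lemma size_tree_code_query i t0 t1 S : S != set0 ->
  (size (tree_code (Query i t0 t1) S) <=
    2 + minn (size (tree_code t0 (S :\ i))) (size (tree_code t1 (S :\ i))))%N.
Proof.
move=> nS; rewrite [tree_code (Query _ _ _) _]/= (negPf nS).
case: ifP => // _; rewrite /= !add2n !ltnS.
by rewrite leq_min; case: ifPn => [->|]; rewrite ?leqnn // -ltnNge => /ltnW->.
Qed.

Lemma code_length_tree_code (R : realFieldType) t : repeat_free t ->
  code_length (spectral_dist R (dt_eval t)) (tree_code t) <= 2 * path_variance R t.
Proof.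
elim: t => [b|i t0 IH0 t1 IH1].
  move=> _; rewrite mulr0 /code_length big1 // => S _.
  have [->|nS] := eqVneq S set0; first by rewrite tree_code0 mulr0.
  (* A constant function has no variance, hence no mass on any nonempty set. *)
  have var0 : variance R (dt_eval (@Leaf n b)) = 0.
    by rewrite /variance fourier0 expect_cst bsign_sqr subrr.
  move: var0; rewrite varianceE => /eqP.
  rewrite psumr_eq0 => [|T _]; last exact: sqr_ge0.
  move=> /allP/(_ S); rewrite mem_index_enum nS => /(_ isT)/eqP e.
  by rewrite /spectral_dist e mul0r.
move=> /and4P[r0 r1 f0 f1].
set f := dt_eval (Query i t0 t1).
pose m S := minn (size (tree_code t0 S)) (size (tree_code t1 S)).
(* The two leading letters are charged to nonempty sets only, whose total mass is the variance. *)
have step : code_length (spectral_dist R f) (tree_code (Query i t0 t1)) <=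
    2 * variance R f + \sum_S spectral_dist R f S * (m (S :\ i))%:R.
  rewrite /code_length varianceE mulr_sumr [X in X + _]big_mkcond -big_split.
  apply: ler_sum => S _; have [->|nS] := eqVneq S set0.
    by rewrite !tree_code0 !mulr0 addr_ge0 // mulr_ge0 ?sqr_ge0.
  have le2 : (size (tree_code (Query i t0 t1) S))%:R <= 2 + (m (S :\ i))%:R :> R.
    by rewrite -natrD ler_nat size_tree_code_query.
  apply: le_trans (ler_wpM2l (sqr_ge0 _) le2) _.
  by rewrite mulrDr [_ * 2]mulrC.
apply: le_trans step _.
(* The length [m] agrees on [S] and [i |: S], so their masses combine through [spectral_if]. *)
have -> : \sum_S spectral_dist R f S * (m (S :\ i))%:R =
  \sum_(S : {set 'I_n} | i \notin S)
    (spectral_dist R (dt_eval t0) S + spectral_dist R (dt_eval t1) S) / 2 * (m S)%:R.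
  rewrite (sum_set_split i); apply: eq_bigr => S niS.
  rewrite setU1K //; have -> : S :\ i = S.
    by apply/setDidPl; rewrite disjoint_sym disjoints1.
  rewrite -mulrDl /spectral_dist spectral_if //; exact: unread_eval.
(* The minimum is at most either length, so each branch's mass is charged its own codeword; the sets
   containing [i] only add nonnegative terms. *)
have : \sum_(S : {set 'I_n} | i \notin S)
    (spectral_dist R (dt_eval t0) S + spectral_dist R (dt_eval t1) S) / 2 * (m S)%:R
  <= (code_length (spectral_dist R (dt_eval t0)) (tree_code t0) +
      code_length (spectral_dist R (dt_eval t1)) (tree_code t1)) / 2.
  rewrite /code_length -big_split /= mulr_suml.
  rewrite [leLHS]big_mkcond; apply: ler_sum => S _.
  have g0 : 0 <= spectral_dist R (dt_eval t0) S by apply: sqr_ge0.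
  have g1 : 0 <= spectral_dist R (dt_eval t1) S by apply: sqr_ge0.
  case: ifP => _.
    rewrite mulrAC ler_pM2r ?invr_gt0 // mulrDl.
    by apply: lerD; rewrite ler_wpM2l // ler_nat ?geq_minl ?geq_minr.
  by rewrite divr_ge0 // addr_ge0 // mulr_ge0.
have -> : path_variance R (Query i t0 t1) =
  variance R f + (path_variance R t0 + path_variance R t1) / 2 by [].
have := IH0 f0; have := IH1 f1; lra.
Qed.

End Code.

(** * The three letters and the final bound *)

Lemma card3_letters (Sigma : finType) : #|Sigma| = 3%N ->
  exists s0 s1 s2 : Sigma, [/\ s0 != s1, s0 != s2 & s1 != s2].
Proof.
rewrite cardE => h; have := enum_uniq Sigma.
case: (enum Sigma) h => [|a [|b [|c []]]] //= _.
rewrite !inE negb_or andbT => /andP[/andP[ab ac] bc].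
by exists a, b, c; split.
Qed.

Theorem theorem1p6 (R : realFieldType) (Sigma : finType) (hSigma : #|Sigma| = 3%N)
    (n k : nat) (d : R) (f : cube n -> bool) (t : dtree n)
    (hf : computes t f) (hk : read_k k t) (hd : expected_depth R t = d) :
  exists P : {set 'I_n} -> seq Sigma,
    almost_prefix_free P /\
    code_length (spectral_dist R f) P <=
      Num.min ((2 * k + 2)%:R * total_influence R f)
              (4 * total_influence R f + 2 * d).
Proof.
have [s0 [s1 [s2 [s01 s02 s12]]]] := card3_letters hSigma.
pose t' := prune t; have rf : repeat_free t' by apply: prune_repeat_free.
have ef x : dt_eval t' x = f x by rewrite prune_eval hf.
have eF S : fourier R (dt_eval t') S = fourier R f S.
  by apply: eq_expect => x; rewrite ef.
have eI : total_influence R (dt_eval t') = total_influence R f.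
  by apply: eq_bigr => S _; rewrite eF.
exists (tree_code s0 s1 s2 t'); split; first exact: tree_code_almost_prefix_free.
have -> : code_length (spectral_dist R f) (tree_code s0 s1 s2 t') =
    code_length (spectral_dist R (dt_eval t')) (tree_code s0 s1 s2 t').
  by apply: eq_bigr => S _; rewrite /spectral_dist eF.
apply: le_trans (code_length_tree_code s0 s1 s2 R rf) _.
have rk' : read_k k t' by move=> i; apply: leq_trans (prune_reads t i) (hk i).
rewrite le_min; apply/andP; split.
  have := path_variance_reads R rf rk'.
  by rewrite eI natrD natrM -natr1 mulrDl mul1r; lra.
(* The length is at most twice the expected depth of the pruned tree, hence at most [2 * d]; the
   influence term is nonnegative slack. *)
have I0 : 0 <= total_influence R f.
  by apply: sumr_ge0 => S _; rewrite mulr_ge0 ?sqr_ge0.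
have : expected_depth R t' <= d.
  by rewrite -hd; apply: le_expect => x; rewrite ler_nat prune_queries.
by have := path_variance_depth R rf; lra.
Qed.
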